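(* Let $\mathcal{W}$ and $\mathcal{V}$ be finite-dimensional subspaces of the Hilbert space $\mathcal{H}$ such that $\mathcal{H}=\mathcal{V}\oplus\mathcal{W}^{\perp}$, let $I$ be a finite index set and let $\epsilon\ge0$. Let $(\mathbf{W},\mathbf{w})$ be a fusion frame for $\mathcal{W}$. Then $(\mathbf{V},\mathbf{v})$ is an $\epsilon$-approximate oblique component preserving $Q$-dual fusion frame of $(\mathbf{W},\mathbf{w})$ on $\mathcal{V}$ if and only if $V_i=LM_i\mathcal{K}_{\mathbf{W}}$ for each $i\in I$ and $Q=Q_{L,\mathbf{v}}$, for some $L\in\mathfrak{L}_{T_{\mathbf{W},\mathbf{w}}^{*},\epsilon}^{\mathcal{V},\mathcal{W}^{\perp}}$ where $\mathrm{Im}(L)=\mathcal{V}$. Furthermore, any $L\in\mathfrak{L}_{T_{\mathbf{W},\mathbf{w}}^{*},\epsilon}^{\mathcal{V},\mathcal{W}^{\perp}}$ with $\mathrm{Im}(L)=\mathcal{V}$ is of the form $T_{\mathbf{V},\mathbf{v}}Q$ where $(\mathbf{V},\mathbf{v})$ is some $\epsilon$-approximate oblique component preserving $Q$-dual fusion frame of $(\mathbf{W},\mathbf{w})$ on $\mathcal{V}$.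
   Context: $\mathcal{H}$ is a separable Hilbert space over $\mathbb{R}$ or $\mathbb{C}$ and $B(\cdot,\cdot)$ denotes bounded linear operators. $\mathcal{H}=\mathcal{V}\oplus\mathcal{W}^{\perp}$ means a direct (not necessarily orthogonal) sum; $\pi_{\mathcal{V},\mathcal{W}^{\perp}}$ is the oblique projection with image $\mathcal{V}$ and kernel $\mathcal{W}^{\perp}$. For finite-dimensional subspaces only fusion frames with a finite index set $I$ are considered. $\mathbf{W}=\{W_i\}_{i\in I}$ is a family of closed subspaces of $\mathcal{W}$ and $\mathbf{w}=\{w_i\}_{i\in I}$ a family of weights, i.e. $w_i>0$; $(\mathbf{W},\mathbf{w})$ stands for $\{(W_i,w_i)\}_{i\in I}$. $\mathcal{K}_{\mathbf{W}}=\oplus_{i\in I}W_i$ (Hilbert direct sum). $(\mathbf{W},\mathbf{w})$ is a fusion frame for $\mathcal{W}$ if there are $0<\alpha\le\beta<\infty$ with $\alpha\|f\|^2\le\sum_{i\in I}w_i^2\|\pi_{W_i}f\|^2\le\beta\|f\|^2$ for all $f\in\mathcal{W}$ ($\pi_{W_i}$ the orthogonal projection onto $W_i$). Its synthesis operator is $T_{\mathbf{W},\mathbf{w}}:\mathcal{K}_{\mathbf{W}}\to\mathcal{H}$, $(f_i)_{i}\mapsto\sum_i w_if_i$, with adjoint $T_{\mathbf{W},\mathbf{w}}^{*}f=(w_i\pi_{W_i}f)_{i}$. Likewise $\mathbf{V}=\{V_i\}_{i\in I}$ is a family of closed subspaces of $\mathcal{V}$ with a family of weights $\mathbf{v}=\{v_i\}_{i\in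 I}$, and $Q\in B(\mathcal{K}_{\mathbf{W}},\mathcal{K}_{\mathbf{V}})$. For $j\in I$, $M_j$ denotes the operator on $\mathcal{K}_{\mathbf{W}}$ (or $\mathcal{K}_{\mathbf{V}}$) which keeps the $j$-th component and replaces all the others by $0$. $Q\in B(\mathcal{K}_{\mathbf{W}},\mathcal{K}_{\mathbf{V}})$ is component preserving if $QM_j\mathcal{K}_{\mathbf{W}}=M_j\mathcal{K}_{\mathbf{V}}$ for each $j\in I$. A fusion frame $(\mathbf{V},\mathbf{v})$ for $\mathcal{V}$ is an $\epsilon$-approximate oblique $Q$-dual fusion frame of $(\mathbf{W},\mathbf{w})$ on $\mathcal{V}$ if $\|T_{\mathbf{V},\mathbf{v}}QT_{\mathbf{W},\mathbf{w}}^{*}-\pi_{\mathcal{V},\mathcal{W}^{\perp}}\|\le\epsilon$; it is an $\epsilon$-approximate oblique component preserving $Q$-dual fusion frame if moreover $Q$ is component preserving. $\mathfrak{L}_{T_{\mathbf{W},\mathbf{w}}^{*},\epsilon}^{\mathcal{V},\mathcal{W}^{\perp}}=\{U\in B(\mathcal{K}_{\mathbf{W}},\mathcal{H}):\|UT_{\mathbf{W},\mathbf{w}}^{*}-\pi_{\mathcal{V},\mathcal{W}^{\perp}}\|\le\epsilon\text{ and }\mathrm{Im}(U)=\mathcal{V}\}$. For $L\in B(\mathcal{K}_{\mathbf{W}},\mathcal{V})$ and $V_i=LM_i\mathcal{K}_{\mathbf{W}}$, $Q_{L,\mathbf{v}}:\mathcal{K}_{\mathbf{W}}\to\mathcal{K}_{\mathbf{V}}$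 is defined by $Q_{L,\mathbf{v}}(f_j)_{j\in I}=\left(\frac{1}{v_i}LM_i(f_j)_{j\in I}\right)_{i\in I}$. *)

(* Defs.v *)
From HB Require Import structures.
From mathcomp Require Import all_boot all_order all_algebra.
From mathcomp Require Import all_classical all_reals all_analysis.
From mathcomp Require Import complex.

Set Implicit Arguments.
Unset Strict Implicit.
Unset Printing Implicit Defensive.

Import Order.TTheory GRing.Theory Num.Theory.
Import numFieldNormedType.Exports.

Local Open Scope classical_set_scope.
Local Open Scope ring_scope.

Variant scalar_kind := RealScalars | ComplexScalars.

Definition scalar (R : realType) (k : scalar_kind) : numFieldType :=
  match k with RealScalars => R | ComplexScalars => complex R end.

Definition conj_scalar (R : realType) (k : scalar_kind) :
    scalar R k -> scalar R k :=
  match k with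
  | RealScalars => idfun
  | ComplexScalars => @Num.conj (complex R)
  end.

Definition of_real (R : realType) (k : scalar_kind) : R -> scalar R k :=
  match k with
  | RealScalars => idfun
  | ComplexScalars => @real_complex R
  end.

Definition real_part (R : realType) (k : scalar_kind) : scalar R k -> R :=
  match k with
  | RealScalars => idfun
  | ComplexScalars => @complex.Re R
  end.

Arguments conj_scalar {R} k _.
Arguments of_real {R} k _.
Arguments real_part {R k} _.

HB.mixin Record CompleteNormedModule_isHilbert (R : realType) (k : scalar_kind)
    H of CompleteNormedModule (scalar R k) H := {
  inner : {dot H for @conj_scalar R k};
  inner_norm : forall x : H, inner x x = `|x| ^+ 2
}.

#[short(type="hilbertType")]
HB.structure Definition Hilbert (R : realType) (k : scalar_kind) :=
  {H of CompleteNormedModule (scalar R k) H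
      & CompleteNormedModule_isHilbert R k H}.

Definition separable (T : topologicalType) :=
  exists2 D : set T, countable D & dense D.

(* The library norm `|x| of a vector has its values in the scalar field. *)
Definition hnorm (R : realType) (k : scalar_kind) (H : hilbertType R k)
  (x : H) : R := real_part `|x|.

Section Subspaces.
Context {R : realType} {k : scalar_kind} {H : hilbertType R k}.
Implicit Types A B W : set H.

Definition closed_subspace A := submod_closed [pred x in A] /\ closed A.

Definition finite_dim_subspace A := exists (n : nat) (e : 'I_n -> H),
  A = range (fun c : 'I_n -> scalar R k => \sum_(j < n) c j *: e j).

Definition ortho_compl W : set H := [set x | forall y, W y -> inner x y = 0].

Definition direct_sum A B :=
  A `&` B = [set 0] /\ [set x + y | x in A & y in B] = [set: H].

(* Meaningful when direct_sum A B: image A, kernel B. *)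
Definition oblique_proj A B (x : H) : H := xget 0 [set y | A y /\ B (x - y)].

Definition ortho_proj W : H -> H := oblique_proj W (ortho_compl W).

End Subspaces.

Section BoundedOperators.
Context {R : realType} {k : scalar_kind} {E F : lmodType (scalar R k)}.
Variables (normE : E -> R) (normF : F -> R).

(* An operator between subspaces A of E and B of F is a function E -> F of
   which only the values on A matter. *)
Definition op_norm (A : set E) (T : E -> F) : \bar R :=
  ereal_sup [set (normF (T x))%:E | x in [set x | A x /\ normE x <= 1]].

Definition bounded_operator (A : set E) (B : set F) (T : E -> F) :=
  [/\ forall x, A x -> B (T x),
      forall a, {in A &, forall x y, T (a *: x + y) = a *: T x + T y} &
      (op_norm A T < +oo)%E].

End BoundedOperators.

Section FusionFrames.
Context {R : realType} {k : scalar_kind} {H : hilbertType R k} {I : finType}.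
Implicit Types (S : set H) (W V : I -> set H) (w v : I -> R).
Implicit Types (f : {ffun I -> H}).

Definition hsum W : set {ffun I -> H} := [set f | forall i, W i (f i)].

Definition hsum_norm f : R := Num.sqrt (\sum_i hnorm (f i) ^+ 2).

Definition fusion_frame S W w :=
  [/\ forall i, closed_subspace (W i) /\ W i `<=` S,
      forall i, 0 < w i &
      exists alpha beta : R, [/\ 0 < alpha, alpha <= beta &
        forall x, S x ->
          alpha * hnorm x ^+ 2
            <= \sum_i w i ^+ 2 * hnorm (ortho_proj (W i) x) ^+ 2
            <= beta * hnorm x ^+ 2]].

Definition synthesis w f : H := \sum_i of_real k (w i) *: f i.

(* The adjoint of [synthesis w] on [hsum W]; see [synthesis_adjoint]. *)
Definition analysis W w (x : H) : {ffun I -> H} :=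
  [ffun i => of_real k (w i) *: ortho_proj (W i) x].

Definition component (j : I) f : {ffun I -> H} :=
  [ffun i => if i == j then f i else 0].

Definition component_preserving W V (Q : {ffun I -> H} -> {ffun I -> H}) :=
  forall j, Q @` (component j @` hsum W) = component j @` hsum V.

(* SV and SW are the subspaces of H carrying the fusion frames (V, v) and
   (W, w). *)
Definition approx_oblique_proj (eps : R) (SV SW : set H) (T : H -> H) :=
  (op_norm (@hnorm R k H) (@hnorm R k H) [set: H]
     (fun x => T x - oblique_proj SV (ortho_compl SW) x)%R <= eps%:E)%E.

Definition approx_oblique_dual (eps : R) (SV SW : set H) W w V v
    (Q : {ffun I -> H} -> {ffun I -> H}) :=
  [/\ fusion_frame SV V v,
      bounded_operator hsum_norm hsum_norm (hsum W) (hsum V) Q &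
      approx_oblique_proj eps SV SW
        (fun x => synthesis v (Q (analysis W w x)))].

Definition approx_oblique_cp_dual (eps : R) (SV SW : set H) W w V v
    (Q : {ffun I -> H} -> {ffun I -> H}) :=
  approx_oblique_dual eps SV SW W w V v Q /\ component_preserving W V Q.

(* Approximate, relative to the oblique projection onto SV, left inverses of
   [analysis W w] with image exactly SV. *)
Definition approx_left_inverses (eps : R) (SV SW : set H) W w :
    set ({ffun I -> H} -> H) :=
  [set U | [/\ bounded_operator hsum_norm (@hnorm R k H) (hsum W) setT U,
               approx_oblique_proj eps SV SW (fun x => U (analysis W w x)) &
               U @` hsum W = SV]].

Definition Q_of (L : {ffun I -> H} -> H) v f : {ffun I -> H} :=
  [ffun i => (of_real k (v i))^-1 *: L (component i f)].

End FusionFrames.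

Lemma conj_of_real (R : realType) (k : scalar_kind) (a : R) :
  conj_scalar k (of_real k a) = of_real k a.
Proof. by case: k => //=; exact: conjc_real. Qed.

Lemma inner_conj (R : realType) (k : scalar_kind) (H : hilbertType R k)
  (x y : H) : inner x y = conj_scalar k (inner y x).
Proof.
by rewrite [LHS](@hermitian_subproof _ _ _ _ inner) /= expr0 mul1r.
Qed.

Lemma conj_scalar0 (R : realType) (k : scalar_kind) :
  conj_scalar k (0 : scalar R k) = 0.
Proof. by case: k => //=; exact: rmorph0. Qed.

Lemma oblique_projP (R : realType) (k : scalar_kind) (H : hilbertType R k)
  (A B : set H) (x : H) : direct_sum A B ->
  A (oblique_proj A B x) /\ B (x - oblique_proj A B x).
Proof.
case=> _ AB; rewrite /oblique_proj.
case: xgetP => [y -> //|noy].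
have : [set x + y | x in A & y in B] x by rewrite AB.
by case=> y Ay [z Bz xE]; case: (noy y); split=> //; rewrite -xE addrC addKr.
Qed.

Lemma synthesis_adjoint (R : realType) (k : scalar_kind)
  (H : hilbertType R k) (I : finType) (W : I -> set H) (w : I -> R)
  (f : {ffun I -> H}) (x : H) :
  (forall i, direct_sum (W i) (ortho_compl (W i))) -> hsum W f ->
  inner (synthesis w f) x = \sum_i inner (f i) (analysis W w x i).
Proof.
move=> Wsum fW; rewrite /synthesis linear_sumlz; apply: eq_bigr => i _.
have [_ xW] := oblique_projP x (Wsum i).
rewrite linearZl_LR /analysis ffunE linearZr_LR /= conj_of_real; congr (_ * _).
rewrite -{1}(subrK (ortho_proj (W i) x) x) linearDr /=.
by rewrite [X in X + _]inner_conj (xW _ (fW i)) conj_scalar0 add0r.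
Qed.

(* Main.v *)
Require Import Defs.
From mathcomp Require Import all_boot all_order all_algebra.
From mathcomp Require Import all_classical all_reals all_analysis.
From mathcomp Require Import complex.

Set Implicit Arguments.
Unset Strict Implicit.
Unset Printing Implicit Defensive.

Import Order.TTheory GRing.Theory Num.Theory.
Import numFieldNormedType.Exports.

Local Open Scope classical_set_scope.
Local Open Scope ring_scope.

(** Given a dual pair (V, Q), the operator [L = synthesis v \o Q] satisfies the
same approximation bound, since [L (analysis W w x)] is literally the operator
whose distance to the oblique projection is measured.  Conversely, given [L],
each [f] is the sum of its components, so [synthesis v (Q_of L v f)], the sum of
the [v i * (v i)^-1 * L (component i f)], is [L f].  The two constructions
therefore preserve the approximation condition, and what has to
be checked is that they match the remaining conditions:

- component preservation corresponds to [V i = L @` (component i @` hsum W)]: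
  [synthesis v] sends the i-th summand of [hsum V] onto [V i]
  ([synthesis_component_image]), and a component preserving [Q] is determined
  by what it does on each summand ([component_preserving_coord]);

- the fusion frame inequalities for (V, v) correspond to [L] having image [SV].
  As [Q] maps [hsum W] onto [hsum V] ([component_preserving_onto]), [L] and
  [synthesis v] have the same image, so this is the statement that, in a
  finite-dimensional space, (V, v) is a fusion frame iff the [V i] span
  ([fusion_frame_synthesis], [synthesis_fusion_frame]).

The second point is where analysis enters.  A subspace of a finite-dimensional
space has an orthonormal basis ([orthonormal_basis]), hence an orthogonal
complement ([ortho_compl_sum]) and is closed ([ortho_compl_sum_closed]).  If
(V, v) is a fusion frame, a vector of [SV] orthogonal to every [V i] is killed
by the lower frame bound.  If the [V i] span, each vector [e j] of an
orthonormal basis of [SV] is [synthesis v (g j)] for some [g j]; moving the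
synthesis operator to the other side of the inner product bounds the
coefficients of [x] on [e j] by a multiple of the norm of [analysis V v x],
which is the lower frame bound. *)

(** * Real and complex scalars *)

Section Scalars.
Context {R : realType} {k : scalar_kind}.
Implicit Types (a b : R) (z : Defs.scalar R k).

Lemma of_realK a : real_part (of_real k a) = a.
Proof. by case: k. Qed.

Lemma of_real_part z : 0 <= z -> of_real k (real_part z) = z.
Proof.
by case: k z => //= -[x y]; rewrite lecE /= => /andP[/eqP->].
Qed.

Lemma of_realD a b : of_real k (a + b) = of_real k a + of_real k b.
Proof. by case: k => //=; apply: rmorphD. Qed.

Lemma of_realM a b : of_real k (a * b) = of_real k a * of_real k b.
Proof. by case: k => //=; apply: rmorphM. Qed.

Lemma of_real1 : of_real k (1 : R) = 1.
Proof. by case: k => //=; apply: rmorph1. Qed.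

Lemma ler_of_real a b : (of_real k a <= of_real k b) = (a <= b).
Proof. by case: k => //=; apply: ler0c || rewrite lecR. Qed.

Lemma of_real_inj : injective (@of_real R k).
Proof. by move=> a b /(congr1 real_part); rewrite !of_realK. Qed.

Lemma of_real_neq0 a : a != 0 -> of_real k a != 0.
Proof.
apply: contra_neq => a0; rewrite -(of_realK a) a0.
by case: k.
Qed.

Lemma normr_of_real a : 0 <= a -> `|of_real k a| = of_real k a.
Proof.
move=> a0; apply: ger0_norm.
have -> : 0 = of_real k (0 : R) by case: k.
by rewrite ler_of_real.
Qed.

Lemma of_realV a : of_real k a^-1 = (of_real k a)^-1.
Proof. by case: k => //=; exact: fmorphV. Qed.

Lemma of_real_sum (J : Type) (r : seq J) (F : J -> R) :
  of_real k (\sum_(j <- r) F j) = \sum_(j <- r) of_real k (F j).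
Proof. by apply: big_morph; [exact: of_realD | case: k]. Qed.

Lemma normr_conj_scalar z : `|conj_scalar k z| = `|z|.
Proof. by case: k z => //= z; exact: norm_conjC. Qed.

End Scalars.

(** * Norm and inner product *)

Section Norm.
Context {R : realType} {k : scalar_kind} {H : hilbertType R k}.
Implicit Types (x y : H) (z : Defs.scalar R k).

Lemma of_real_hnorm x : of_real k (hnorm x) = `|x|.
Proof. exact: of_real_part. Qed.

Lemma hnorm_ge0 x : 0 <= hnorm x.
Proof.
rewrite -(ler_of_real (k := k)) of_real_hnorm.
by have -> : of_real k (0 : R) = 0 by case: k.
Qed.

Lemma hnorm0 : hnorm (0 : H) = 0.
Proof. by rewrite /hnorm normr0; case: k. Qed.

Lemma hnorm_eq0 x : hnorm x = 0 -> x = 0.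
Proof.
move=> x0; apply/eqP; rewrite -normr_eq0 -of_real_hnorm x0.
by case: k.
Qed.

Lemma ler_hnormD x y : hnorm (x + y) <= hnorm x + hnorm y.
Proof.
by rewrite -(ler_of_real (k := k)) of_realD !of_real_hnorm ler_normD.
Qed.

Lemma ler_hnorm_sum (J : Type) (r : seq J) (F : J -> H) :
  hnorm (\sum_(j <- r) F j) <= \sum_(j <- r) hnorm (F j).
Proof.
elim: r => [|j r IH]; first by rewrite !big_nil hnorm0.
by rewrite !big_cons (le_trans (ler_hnormD _ _)) // lerD2l.
Qed.

Lemma hnormZ z x : hnorm (z *: x) = real_part `|z| * hnorm x.
Proof.
apply: (@of_real_inj _ k).
by rewrite of_realM !of_real_hnorm of_real_part ?normrZ.
Qed.

Lemma hnormZ_real (a : R) x : 0 <= a -> hnorm (of_real k a *: x) = a * hnorm x.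
Proof. by move=> a0; rewrite hnormZ normr_of_real // of_realK. Qed.

Lemma inner_hnorm x : inner x x = of_real k (hnorm x ^+ 2).
Proof. by rewrite inner_norm expr2 of_realM of_real_hnorm. Qed.

Lemma inner_sym0 x y : inner x y = 0 -> inner y x = 0.
Proof. by move=> xy; rewrite inner_conj xy conj_scalar0. Qed.

Lemma pythagoras x y : inner x y = 0 ->
  hnorm (x + y) ^+ 2 = hnorm x ^+ 2 + hnorm y ^+ 2.
Proof.
move=> xy; apply: (@of_real_inj _ k); rewrite of_realD -!inner_hnorm.
by rewrite linearDl /= !linearDr /= xy (inner_sym0 xy) addr0 add0r.
Qed.

(** [x - c *: y] and [c *: y] are orthogonal for the projection coefficient [c],
so Pythagoras bounds the norm of [c *: y] by that of [x]. *)
Lemma cauchy_schwarz x y : real_part `|inner x y| <= hnorm x * hnorm y.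
Proof.
have [->|y0] := eqVneq y 0.
  by rewrite linear0r normr0 hnorm0 mulr0; case: k.
have yy0 : inner y y != 0 by rewrite inner_norm expf_neq0 // normr_eq0.
pose c := inner x y / inner y y.
have cy : inner (x - c *: y) (c *: y) = 0.
  rewrite linearZr_LR /= linearBl /= linearZl_LR /= divfK //.
  by rewrite subrr mulr0.
have /(congr1 (of_real k)) := pythagoras cy.
rewrite subrK => xE.
have cyx : hnorm (c *: y) <= hnorm x.
  rewrite -ler_sqr ?nnegrE ?hnorm_ge0 //.
  by rewrite (of_real_inj xE) lerDr sqr_ge0.
suff -> : real_part `|inner x y| = hnorm (c *: y) * hnorm y.
  by rewrite ler_wpM2r // hnorm_ge0.
apply: (@of_real_inj _ k); rewrite of_realM !of_real_hnorm of_real_part //.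
rewrite normrZ normrM normfV inner_norm normrX normr_id expr2 -!mulrA.
by rewrite mulVf ?mulr1 // mulf_neq0 ?normr_eq0.
Qed.

End Norm.

(** * Linear subspaces *)

Section Subspace.
Context {K : fieldType} {E : lmodType K}.
Implicit Types (A : set E) (a : K) (x y : E).

Definition linear_subspace A :=
  A 0 /\ forall a x y, A x -> A y -> A (a *: x + y).

Lemma submod_closedP A : submod_closed [pred x in A] <-> linear_subspace A.
Proof.
split=> -[A0 AL]; split=> [|a x y].
- by have := A0; rewrite !inE.
- by have := AL a x y; rewrite !inE.
- by rewrite !inE.
- by rewrite !inE; exact: AL.
Qed.

Context {A : set E} (Asub : linear_subspace A).

Lemma subspaceD x y : A x -> A y -> A (x + y).
Proof. by rewrite -{2}(scale1r x); exact: Asub.2. Qed.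

Lemma subspaceZ a x : A x -> A (a *: x).
Proof.
by move=> Ax; rewrite -[_ *: _]addr0; apply: Asub.2 => //; exact: Asub.1.
Qed.

Lemma subspaceB x y : A x -> A y -> A (x - y).
Proof. by move=> Ax Ay; rewrite addrC -scaleN1r; exact: Asub.2. Qed.

Lemma subspace_sum (J : Type) (r : seq J) (F : J -> E) :
  (forall j, A (F j)) -> A (\sum_(j <- r) F j).
Proof.
by move=> AF; elim/big_ind : _ => //; [exact: Asub.1 | exact: subspaceD].
Qed.

End Subspace.

(** * Orthonormal bases and orthogonal complements *)

Section FiniteDimension.
Context {R : realType} {k : scalar_kind} {H : hilbertType R k}.
Implicit Types (A B : set H) (x y : H).

Lemma finite_dim_is_subspace A : finite_dim_subspace A -> linear_subspace A.
Proof.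
move=> [n [e ->]]; split=> [|a _ _ [c _ <-] [d _ <-]].
  by exists (fun=> 0) => //; rewrite big1 // => j _; rewrite scale0r.
exists (fun j => a * c j + d j) => //.
rewrite scaler_sumr -big_split; apply: eq_bigr => j _ /=.
by rewrite scalerDl scalerA.
Qed.

Definition orthonormal (m : nat) (e : 'I_m -> H) :=
  forall i j, inner (e i) (e j) = (i == j)%:R.

Definition expansion (m : nat) (e : 'I_m -> H) x := \sum_j inner x (e j) *: e j.

Lemma expansion_ortho (m : nat) (e : 'I_m -> H) x i :
  orthonormal e -> inner (x - expansion e x) (e i) = 0.
Proof.
move=> eo; rewrite linearBl /= linear_sumlz (bigD1 i) //=.
rewrite big1 => [|j /negPf ji].
  by rewrite linearZl_LR /= eo eqxx mulr1 addr0 subrr.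
by rewrite linearZl_LR /= eo ji mulr0.
Qed.

(** The Gram matrix of [e] is the identity of size [m] and factors through the
coefficients of [e] on [b], so its rank is at most [n]. *)
Lemma orthonormal_size (n m : nat) (b : 'I_n -> H) (e : 'I_m -> H) :
  orthonormal e ->
  (forall j,
    range (fun c : 'I_n -> Defs.scalar R k => \sum_l c l *: b l) (e j)) ->
  (m <= n)%N.
Proof.
move=> eo eb.
have /choice[c cE] : forall j, exists c : 'I_n -> Defs.scalar R k,
    \sum_l c l *: b l = e j.
  by move=> j; have [c _ <-] := eb j; exists c.
pose C := \matrix_(j < m, l < n) c j l.
pose G := \matrix_(l < n, j < m) inner (b l) (e j).
have CG : C *m G = 1%:M.
  apply/matrixP => i j; rewrite !mxE -eo -cE linear_sumlz.
  by apply: eq_bigr => l _; rewrite !mxE linearZl_LR.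
rewrite -(mxrank1 (Defs.scalar R k) m) -CG.
exact: leq_trans (mxrankM_maxl _ _) (rank_leq_col _).
Qed.

(** A maximal orthonormal family of [B] exists because [orthonormal_size] bounds
the size of these families.  It spans [B]: a nonzero remainder
[x - expansion e x] could be normalized and added to it. *)
Lemma orthonormal_basis A B :
  finite_dim_subspace A -> linear_subspace B -> B `<=` A ->
  exists (m : nat) (e : 'I_m -> H),
    [/\ orthonormal e, forall j, B (e j) & forall x, B x -> x = expansion e x].
Proof.
move=> [n [b AE]] Bsub BA.
pose P m := `[< exists e : 'I_m -> H, orthonormal e /\ forall j, B (e j) >].
have P0 : exists m, P m.
  by exists 0%N; apply/asboolP; exists (fun=> 0); split=> -[].
have Pn m : P m -> (m <= n)%N.
  move=> /asboolP[e [eo eB]]; apply: (orthonormal_size (b := b) eo) => j.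
  by rewrite -AE; exact/BA.
have [m /asboolP[e [eo eB]] mmax] := ex_maxnP P0 Pn.
exists m, e; split=> // x Bx; apply/eqP; rewrite -subr_eq0; apply/eqP.
set y := x - _; apply/eqP/negPn/negP => y0.
have By : B y.
  apply: subspaceB => //; apply: subspace_sum => // j; exact: subspaceZ.
have ye j : inner y (e j) = 0 by exact: expansion_ortho.
suff /mmax : P m.+1 by rewrite ltnn.
pose u := `|y|^-1 *: y.
apply/asboolP; exists (fun i => if unlift ord0 i is Some j then e j else u).
split=> [i j|i]; last first.
  by case: unliftP => [j|] _ //; exact: subspaceZ.
have ue l : inner u (e l) = 0 by rewrite linearZl_LR /= ye mulr0.
case: (unliftP ord0 i) => [i' ->|->]; case: (unliftP ord0 j) => [j' ->|->].
- by rewrite eo (inj_eq lift_inj).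
- by rewrite eq_sym (negPf (neq_lift _ _)) (inner_sym0 (ue _)).
- by rewrite (negPf (neq_lift _ _)) ue.
- by rewrite eqxx inner_norm normrZ normfV normr_id mulVf ?normr_eq0 // expr1n.
Qed.

Lemma ortho_compl_sum A B :
  finite_dim_subspace A -> linear_subspace B -> B `<=` A ->
  direct_sum B (ortho_compl B).
Proof.
move=> Afin Bsub BA; have [m [e [eo eB Be]]] := orthonormal_basis Afin Bsub BA.
split.
  apply/seteqP; split=> [x [Bx /(_ _ Bx)]|_ ->].
    by rewrite inner_norm => /eqP; rewrite expf_eq0 normr_eq0 => /eqP.
  by split=> [|y _]; [exact: Bsub.1 | rewrite linear0l].
rewrite -subTset => x _; exists (expansion e x).
  by apply: subspace_sum => // j; exact: subspaceZ.
exists (x - expansion e x); last by rewrite addrC subrK.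
move=> y /Be ->; rewrite linear_sumr big1 // => j _.
by rewrite linearZr_LR /= expansion_ortho // mulr0.
Qed.

(** By Pythagoras the ball around [x] whose radius is the distance from [x] to
its projection on [B] misses [B]. *)
Lemma ortho_compl_sum_closed B :
  linear_subspace B -> direct_sum B (ortho_compl B) -> closed B.
Proof.
move=> Bsub Bsum x xB; have [] := oblique_projP x Bsum.
set p := oblique_proj _ _ _; set y := x - p => Bp yB.
have [/eqP|y0] := eqVneq y 0; first by rewrite subr_eq0 => /eqP ->.
have [z [Bz]] := xB _ (nbhsx_ballx x `|y| ltac:(by rewrite normr_gt0)).
rewrite -ball_normE /= => xz; exfalso; move: xz; apply/negP.
have := pythagoras (yB _ (subspaceB Bsub Bp Bz)).
have -> : y + (p - z) = x - z by rewrite /y addrA subrK.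
move=> xzE; rewrite le_gtF // -!of_real_hnorm ler_of_real.
by rewrite -ler_sqr ?nnegrE ?hnorm_ge0 // xzE lerDl sqr_ge0.
Qed.

End FiniteDimension.

Section OrthoProj.
Context {R : realType} {k : scalar_kind} {H : hilbertType R k}.
Context {B : set H} (Bsum : direct_sum B (ortho_compl B)).
Implicit Types (x y g : H).

Lemma ortho_proj_hnorm x : hnorm (ortho_proj B x) <= hnorm x.
Proof.
have [Bp px] := oblique_projP x Bsum.
rewrite -ler_sqr ?nnegrE ?hnorm_ge0 //.
rewrite -[in leRHS](subrK (ortho_proj B x) x) (pythagoras (px _ Bp)).
by rewrite lerDr sqr_ge0.
Qed.

Lemma inner_ortho_proj g x : B g -> inner g x = inner g (ortho_proj B x).
Proof.
move=> Bg; have [_ px] := oblique_projP x Bsum.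
rewrite -{1}(subrK (ortho_proj B x) x) linearDr /=.
by rewrite (inner_sym0 (px _ Bg)) add0r.
Qed.

Lemma ortho_proj_eq0 x : ortho_compl B x -> ortho_proj B x = 0.
Proof.
move=> xB; have [Bp _] := oblique_projP x Bsum.
apply/eqP; rewrite -normr_eq0 -sqrf_eq0 -inner_norm -inner_ortho_proj //.
by rewrite (inner_sym0 (xB _ Bp)).
Qed.

End OrthoProj.

(** * Operators that are linear on a subspace *)

Section LinearOn.
Context {K : fieldType} {E F : lmodType K}.
Implicit Types (A : set E) (T : E -> F).

Definition linear_on A T :=
  forall a x y, A x -> A y -> T (a *: x + y) = a *: T x + T y.

Context {A : set E} {T : E -> F}.
Hypotheses (Asub : linear_subspace A) (Tlin : linear_on A T).

Lemma linear_on0 : T 0 = 0.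
Proof.
have := Tlin 1 Asub.1 Asub.1; rewrite !scale1r addr0 => /eqP.
by rewrite -subr_eq0 opprD addNKr oppr_eq0 => /eqP.
Qed.

Lemma linear_onZ a x : A x -> T (a *: x) = a *: T x.
Proof.
move=> Ax; have := Tlin a Ax Asub.1.
by rewrite linear_on0 !addr0.
Qed.

Lemma linear_on_sum (J : Type) (r : seq J) (f : J -> E) :
  (forall j, A (f j)) -> T (\sum_(j <- r) f j) = \sum_(j <- r) T (f j).
Proof.
move=> Af; elim: r => [|j r IH]; first by rewrite !big_nil linear_on0.
rewrite !big_cons -IH -[in LHS](scale1r (f j)) Tlin ?scale1r //.
exact: subspace_sum.
Qed.

End LinearOn.

Lemma linear_on_image (K : fieldType) (E F : lmodType K) (A : set E)
    (T : E -> F) :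
  linear_subspace A -> linear_on A T -> linear_subspace (T @` A).
Proof.
move=> Asub Tlin; split=> [|a _ _ [x Ax <-] [y Ay <-]].
  by exists 0; [exact: Asub.1 | exact: linear_on0 Tlin].
by exists (a *: x + y); [exact: Asub.2 | exact: Tlin].
Qed.

Lemma bounded_operatorP (R : realType) (k : scalar_kind)
    (E F : lmodType (Defs.scalar R k)) (normE : E -> R) (normF : F -> R)
    (A : set E) (B : set F) (T : E -> F) :
  bounded_operator normE normF A B T <->
  [/\ forall x, A x -> B (T x), linear_on A T &
      exists C, forall x, A x -> normE x <= 1 -> normF (T x) <= C].
Proof.
split=> -[AB Tlin Tbdd]; split=> //.
- by move=> a x y Ax Ay; apply: Tlin; exact/mem_set.
- case opE : (op_norm normE normF A T) Tbdd => [r| |] // _.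
    exists r => x Ax x1; rewrite -lee_fin -opE.
    by apply: ereal_sup_ubound; exists x.
  exists 0 => x Ax x1.
  have : ((normF (T x))%:E <= op_norm normE normF A T)%E.
    by apply: ereal_sup_ubound; exists x.
  by rewrite opE.
- by move=> a x y /set_mem Ax /set_mem Ay; exact: Tlin.
- have [C TC] := Tbdd; apply: (@le_lt_trans _ _ C%:E); last exact: ltry.
  by apply: ge_ereal_sup => _ [x [Ax x1] <-]; rewrite lee_fin TC.
Qed.

(** * Direct sums, synthesis and analysis *)

Section DirectSum.
Context {R : realType} {k : scalar_kind} {H : hilbertType R k} {I : finType}.
Implicit Types (W V : I -> set H) (v : I -> R) (f g : {ffun I -> H}).

Lemma hsum_subspace W :
  (forall i, linear_subspace (W i)) -> linear_subspace (hsum W).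
Proof.
move=> Wsub; split=> [i|a f g fW gW i]; rewrite !ffunE.
  exact: (Wsub i).1.
exact: (Wsub i).2.
Qed.

Lemma sum_component f : f = \sum_j component j f.
Proof.
apply/ffunP => i; rewrite sum_ffunE (bigD1 i) //= ffunE eqxx big1 ?addr0 //.
by move=> j /negPf ji; rewrite ffunE eq_sym ji.
Qed.

Lemma component_linear j : linear (component (H := H) (I := I) j).
Proof.
move=> a f g; apply/ffunP => i; rewrite !ffunE.
by case: eqP => // _; rewrite scaler0 addr0.
Qed.

Lemma componentZ j a f : component j (a *: f) = a *: component j f.
Proof. by apply/ffunP => i; rewrite !ffunE; case: eqP; rewrite ?scaler0. Qed.

Lemma componentK j f : component j (component j f) = component j f.
Proof. by apply/ffunP => i; rewrite !ffunE; case: eqP. Qed.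

Lemma component_ne i j f : i != j -> component j f i = 0.
Proof. by rewrite ffunE => /negPf ->. Qed.

Lemma component_component0 i j f : i != j -> component i (component j f) = 0.
Proof.
move=> /negPf ij; apply/ffunP => l; rewrite !ffunE.
by case: eqP => // ->; rewrite ij.
Qed.

Lemma component_linear_on j A : linear_on A (component (H := H) (I := I) j).
Proof. by move=> a f g _ _; exact: component_linear. Qed.

Lemma component_hsum W j f :
  (forall i, linear_subspace (W i)) -> hsum W f -> hsum W (component j f).
Proof.
move=> Wsub fW i; rewrite ffunE; case: eqP => // _.
exact: (Wsub i).1.
Qed.

Lemma component_image_sub W j :
  (forall i, linear_subspace (W i)) -> component j @` hsum W `<=` hsum W.
Proof. by move=> Wsub _ [f fW <-]; exact: component_hsum. Qed.

Lemma hsum_norm_ge0 f : 0 <= hsum_norm f.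
Proof. exact: sqrtr_ge0. Qed.

Lemma sqr_hsum_norm f : hsum_norm f ^+ 2 = \sum_i hnorm (f i) ^+ 2.
Proof. by rewrite sqr_sqrtr // sumr_ge0 // => i _; exact: sqr_ge0. Qed.

Lemma hnorm_le_hsum_norm f i : hnorm (f i) <= hsum_norm f.
Proof.
rewrite -ler_sqr ?nnegrE ?hnorm_ge0 ?hsum_norm_ge0 // sqr_hsum_norm.
by rewrite (bigD1 i) //= lerDl sumr_ge0 // => j _; exact: sqr_ge0.
Qed.

Lemma hsum_norm_component j f : hsum_norm (component j f) <= hsum_norm f.
Proof.
rewrite -ler_sqr ?nnegrE ?hsum_norm_ge0 // !sqr_hsum_norm.
apply: ler_sum => i _; rewrite ffunE; case: eqP => // _.
by rewrite hnorm0 expr0n sqr_ge0.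
Qed.

Lemma hsum_norm_le_sum f : hsum_norm f <= \sum_i hnorm (f i).
Proof.
have S0 (P : pred I) : 0 <= \sum_(i | P i) hnorm (f i).
  by apply: sumr_ge0 => i _; exact: hnorm_ge0.
rewrite -ler_sqr ?nnegrE ?hsum_norm_ge0 // sqr_hsum_norm [leRHS]expr2.
rewrite mulr_suml; apply: ler_sum => i _; rewrite expr2 ler_wpM2l ?hnorm_ge0 //.
by rewrite (bigD1 i) //= lerDl.
Qed.

Lemma synthesis_linear v : linear (synthesis (H := H) v).
Proof.
move=> a f g; rewrite /synthesis scaler_sumr -big_split; apply: eq_bigr => i _.
by rewrite !ffunE scalerDr !scalerA (mulrC a).
Qed.

Lemma synthesis_component v j f :
  synthesis v (component j f) = of_real k (v j) *: f j.
Proof.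
rewrite /synthesis (bigD1 j) //= ffunE eqxx big1 ?addr0 // => i /negPf ij.
by rewrite ffunE ij scaler0.
Qed.

Lemma synthesis_component_image V v j :
  (forall i, linear_subspace (V i)) -> 0 < v j ->
  synthesis v @` (component j @` hsum V) = V j.
Proof.
move=> Vsub v0; apply/seteqP; split=> [_ [_ [f fV <-] <-]|x Vx].
  by rewrite synthesis_component; exact: subspaceZ.
pose g : {ffun I -> H} :=
  component j [ffun=> (of_real k (v j))^-1 *: x].
have gV : hsum V g.
  move=> i; rewrite !ffunE; case: eqP => [->|_]; last exact: (Vsub i).1.
  exact: subspaceZ.
exists (component j g); first by exists g.
by rewrite synthesis_component !ffunE eqxx scalerKV // of_real_neq0 ?lt0r_neq0.
Qed.

Lemma synthesis_sub (S : set H) V v f :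
  linear_subspace S -> (forall i, V i `<=` S) -> hsum V f -> S (synthesis v f).
Proof.
move=> Ssub VS fV; apply: subspace_sum => // i; apply: subspaceZ => //.
exact/VS/fV.
Qed.

Lemma hnorm_synthesis v f :
  (forall i, 0 <= v i) -> hnorm (synthesis v f) <= (\sum_i v i) * hsum_norm f.
Proof.
move=> v0; apply: (le_trans (ler_hnorm_sum _ _)); rewrite mulr_suml.
apply: ler_sum => i _; rewrite hnormZ_real //.
by rewrite ler_wpM2l // hnorm_le_hsum_norm.
Qed.

(** The default value 0 of the projection also lies in [W i]. *)
Lemma analysis_hsum W v x :
  (forall i, linear_subspace (W i)) -> hsum W (analysis W v x).
Proof.
move=> Wsub i; rewrite ffunE; apply: subspaceZ => //.
rewrite /ortho_proj /oblique_proj.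
by case: xgetP => [y _ []//|_]; exact: (Wsub i).1.
Qed.

Lemma sqr_hsum_norm_analysis W v x : (forall i, 0 <= v i) ->
  hsum_norm (analysis W v x) ^+ 2
  = \sum_i v i ^+ 2 * hnorm (ortho_proj (W i) x) ^+ 2.
Proof.
move=> v0; rewrite sqr_hsum_norm; apply: eq_bigr => i _.
by rewrite ffunE hnormZ_real // exprMn.
Qed.

(** The quantitative form of the adjunction between synthesis and analysis that
gives the lower frame bound in [synthesis_fusion_frame]. *)
Lemma inner_synthesis_le V v g x :
  (forall i, direct_sum (V i) (ortho_compl (V i))) -> hsum V g ->
  real_part `|inner (synthesis v g) x|
  <= (\sum_i hnorm (g i)) * hsum_norm (analysis V v x).
Proof.
move=> Vsum gV; rewrite (synthesis_adjoint _ _ Vsum gV).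
rewrite -(ler_of_real (k := k)) of_real_part // mulr_suml of_real_sum.
apply: (le_trans (ler_norm_sum _ _ _)); apply: ler_sum => i _.
rewrite -[leLHS]of_real_part // ler_of_real.
apply: (le_trans (cauchy_schwarz _ _)).
by rewrite ler_wpM2l ?hnorm_ge0 // hnorm_le_hsum_norm.
Qed.

End DirectSum.

(** * Fusion frames of a finite-dimensional space are its spanning families *)

Section Frames.
Context {R : realType} {k : scalar_kind} {H : hilbertType R k} {I : finType}.
Implicit Types (S : set H) (V : I -> set H) (v : I -> R).

Lemma fusion_frame_subspace S V v i :
  fusion_frame S V v -> linear_subspace (V i).
Proof. by move=> [/(_ i)[[/submod_closedP]]]. Qed.

(** Let [U] be the image and [y] the component of [x] orthogonal to [U].  Each
[V i] lies in [U], so all projections of [y] vanish, and so does [y] by the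
lower frame bound. *)
Lemma fusion_frame_synthesis S V v : finite_dim_subspace S ->
  fusion_frame S V v -> synthesis v @` hsum V = S.
Proof.
move=> Sfin Vframe; have Vsub i := fusion_frame_subspace i Vframe.
have [Vcl v0 [alpha [beta [alpha0 _ Vbnd]]]] := Vframe.
have VS i : V i `<=` S by have [] := Vcl i.
have Ssub := finite_dim_is_subspace Sfin.
set U := synthesis v @` hsum V.
have US : U `<=` S by move=> _ [f fV <-]; exact: synthesis_sub fV.
have Usub : linear_subspace U.
  apply: linear_on_image; first exact: hsum_subspace.
  by move=> a f g _ _; exact: synthesis_linear.
have VU i : V i `<=` U.
  rewrite -(synthesis_component_image Vsub (v0 i)).
  by apply: image_subset; exact: component_image_sub.
apply/seteqP; split=> // x Sx.
have [] := oblique_projP x (ortho_compl_sum Sfin Usub US).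
set p := oblique_proj _ _ _; set y := x - p => Up yU.
suff y0 : y = 0 by have /eqP := y0; rewrite subr_eq0 => /eqP ->.
have Sy : S y by apply: subspaceB => //; exact: US.
have /andP[+ _] := Vbnd _ Sy; rewrite big1 => [yle|i _]; last first.
  rewrite ortho_proj_eq0 ?hnorm0 ?expr0n ?mulr0 //.
    exact: (ortho_compl_sum Sfin).
  by move=> z Vz; apply: yU; exact: (VU i).
apply: hnorm_eq0; apply/eqP; rewrite -sqrf_eq0 eq_le sqr_ge0 andbT.
by rewrite pmulr_rle0 in yle.
Qed.

(** The upper bound holds because projections do not increase norms.  For the
lower one, write [x] on an orthonormal basis [e] of [S] and lift each [e j] to
[hsum V]. *)
Lemma synthesis_fusion_frame S V v : finite_dim_subspace S ->
  (forall i, linear_subspace (V i)) -> (forall i, 0 < v i) ->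
  synthesis v @` hsum V = S -> fusion_frame S V v.
Proof.
move=> Sfin Vsub v0 SV; have Ssub := finite_dim_is_subspace Sfin.
have v0' i : 0 <= v i by exact: ltW.
have VS i : V i `<=` S.
  rewrite -SV -(synthesis_component_image Vsub (v0 i)).
  by apply: image_subset; exact: component_image_sub.
have Vsum i : direct_sum (V i) (ortho_compl (V i)).
  exact: ortho_compl_sum (VS i).
split=> // [i|].
  by split=> //; split; [exact/submod_closedP | exact: ortho_compl_sum_closed].
have [m [e [eo eS Se]]] := orthonormal_basis Sfin Ssub (@subset_refl _ S).
have /choice[g gE] : forall j,
    exists g : {ffun I -> H}, hsum V g /\ synthesis v g = e j.
  by move=> j; have := eS j; rewrite -SV => -[g gV gE]; exists g.
(* the sum over j of the bounds of [inner_synthesis_le] with [g := g j] *)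
pose K := \sum_j \sum_i hnorm (g j i).
have K0 : 0 <= K.
  by apply: sumr_ge0 => j _; apply: sumr_ge0 => i _; exact: hnorm_ge0.
have xK x : S x -> hnorm x <= K * hsum_norm (analysis V v x).
  move=> /Se {1}->; apply: (le_trans (ler_hnorm_sum _ _)); rewrite mulr_suml.
  apply: ler_sum => j _; rewrite hnormZ inner_conj normr_conj_scalar.
  have -> : hnorm (e j) = 1.
    apply/eqP; rewrite -sqrp_eq1 ?hnorm_ge0 //; apply/eqP.
    by apply: (@of_real_inj _ k); rewrite -inner_hnorm eo eqxx of_real1.
  by rewrite mulr1 -(gE j).2; apply: inner_synthesis_le => //; exact: (gE j).1.
have K1 : 0 < K ^+ 2 + 1 by rewrite ltr_wpDl ?sqr_ge0.
(* adding 1 keeps alpha positive when K = 0, and gives alpha <= 1 <= beta *)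
exists (K ^+ 2 + 1)^-1, (\sum_i v i ^+ 2 + 1); split; first by rewrite invr_gt0.
  apply: (@le_trans _ _ 1); last first.
    by rewrite lerDr sumr_ge0 // => i _; exact: sqr_ge0.
  by rewrite invf_le1 // lerDr sqr_ge0.
move=> x Sx; apply/andP; split.
  rewrite -sqr_hsum_norm_analysis // mulrC ler_pdivrMr //.
  rewrite mulrDr mulr1 [_ * K ^+ 2]mulrC -exprMn.
  apply: (@le_trans _ _ ((K * hsum_norm (analysis V v x)) ^+ 2)); last first.
    by rewrite lerDl sqr_ge0.
  by rewrite ler_sqr ?nnegrE ?hnorm_ge0 ?mulr_ge0 ?hsum_norm_ge0 // xK.
apply: (@le_trans _ _ ((\sum_i v i ^+ 2) * hnorm x ^+ 2)); last first.
  by rewrite ler_wpM2r ?sqr_ge0 // lerDl.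
rewrite mulr_suml; apply: ler_sum => i _; rewrite ler_wpM2l ?sqr_ge0 //.
by rewrite ler_sqr ?nnegrE ?hnorm_ge0 // ortho_proj_hnorm.
Qed.

End Frames.

(** * Component preserving operators *)

Section Components.
Context {R : realType} {k : scalar_kind} {H : hilbertType R k} {I : finType}.
Implicit Types (V W : I -> set H) (v : I -> R) (f g : {ffun I -> H}).

(** Lift [g] one component at a time, then add up the lifts. *)
Lemma component_preserving_onto W V Q :
  (forall i, linear_subspace (W i)) ->
  (forall f, hsum W f -> hsum V (Q f)) -> linear_on (hsum W) Q ->
  component_preserving W V Q -> Q @` hsum W = hsum V.
Proof.
move=> Wsub QV Qlin Qcp.
apply/seteqP; split=> [_ [f fW <-]|g gV]; first exact: QV.
have /choice[f fE] : forall j, exists f,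
    hsum W (component j f) /\ Q (component j f) = component j g.
  move=> j; have : (component j @` hsum V) (component j g) by exists g.
  rewrite -Qcp => -[_ [f fW <-] QfE]; exists f.
  by split=> //; exact: component_hsum.
exists (\sum_j component j (f j)).
  by apply: subspace_sum (hsum_subspace Wsub) _ _ _ _ => j; have [] := fE j.
rewrite (linear_on_sum (hsum_subspace Wsub)) // => [|j].
  by rewrite [RHS]sum_component; apply: eq_bigr => j _; exact: (fE j).2.
exact: (fE j).1.
Qed.

(** For [j != i], [Q (component j f)] lives in the j-th summand and contributes
nothing to the i-th coordinate of [Q f]. *)
Lemma component_preserving_coord W V Q f i :
  (forall i, linear_subspace (W i)) -> linear_on (hsum W) Q ->
  component_preserving W V Q -> hsum W f -> Q f i = Q (component i f) i.
Proof.
move=> Wsub Qlin Qcp fW; rewrite {1}[f]sum_component.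
rewrite (linear_on_sum (hsum_subspace Wsub)) // => [|j];
  last exact: component_hsum.
rewrite sum_ffunE (bigD1 i) //= big1 ?addr0 // => j ji.
have : (Q @` (component j @` hsum W)) (Q (component j f)).
  by exists (component j f) => //; exists f.
by rewrite Qcp => -[g _ <-]; rewrite component_ne // eq_sym.
Qed.

Lemma component_preserving_comm W V Q f i :
  component_preserving W V Q -> hsum W f ->
  Q (component i f) = component i (Q (component i f)).
Proof.
move=> Qcp fW.
have : (Q @` (component i @` hsum W)) (Q (component i f)).
  by exists (component i f) => //; exists f.
by rewrite Qcp => -[g _ <-]; rewrite componentK.
Qed.

Lemma Q_of_component L v j f :
  L 0 = 0 -> Q_of L v (component j f) = component j (Q_of L v f).
Proof.
move=> L0; apply/ffunP => i; rewrite ffunE [RHS]ffunE.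
case: eqP => [->|/eqP ij]; first by rewrite componentK ffunE.
by rewrite component_component0 // L0 scaler0.
Qed.

(** The weights cancel and the components of [f] add up to [f]. *)
Lemma synthesis_Q_of W L v f :
  (forall i, linear_subspace (W i)) -> linear_on (hsum W) L ->
  (forall i, 0 < v i) -> hsum W f -> synthesis v (Q_of L v f) = L f.
Proof.
move=> Wsub Llin v0 fW; rewrite [in RHS](sum_component f).
rewrite (linear_on_sum (hsum_subspace Wsub)) // => [|j];
  last exact: component_hsum.
apply: eq_bigr => i _.
by rewrite ffunE scalerKV // of_real_neq0 ?lt0r_neq0.
Qed.

End Components.

(** * Duals and approximate left inverses *)

Section Duals.
Context {R : realType} {k : scalar_kind} {H : hilbertType R k} {I : finType}.
Context {SW SV : set H} (SVfin : finite_dim_subspace SV).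
Context {eps : R} {W : I -> set H} {w : I -> R}.
Hypothesis Wsub : forall i, linear_subspace (W i).
Context {v : I -> R} (v0 : forall i, 0 < v i).

Lemma left_inverse_of_dual V Q (L := fun f => synthesis v (Q f)) :
  approx_oblique_cp_dual eps SV SW W w V v Q ->
  [/\ approx_left_inverses eps SV SW W w L,
      forall i, V i = L @` (component i @` hsum W) &
      {in hsum W, Q =1 Q_of L v}].
Proof.
move=> [[Vframe /bounded_operatorP[QV Qlin [C QC]] Qeps] Qcp].
have Vsub i := fusion_frame_subspace i Vframe.
split=> [|i|f /set_mem fW]; first split.
- apply/bounded_operatorP; split=> // [a f g fW gW|].
    by rewrite /L Qlin //; exact: synthesis_linear.
  exists ((\sum_i v i) * C) => f fW f1.
  apply: (le_trans (hnorm_synthesis _ _)) => [i|]; first exact: ltW.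
  by rewrite ler_wpM2l ?QC // sumr_ge0 // => i _; exact: ltW.
- exact: Qeps.
- rewrite -[L]/(synthesis v \o Q) -image_comp.
  rewrite (component_preserving_onto Wsub QV Qlin Qcp).
  exact: fusion_frame_synthesis.
- rewrite -[L]/(synthesis v \o Q) -image_comp Qcp.
  by rewrite synthesis_component_image.
apply/ffunP => i; rewrite ffunE /L (component_preserving_comm i Qcp fW).
rewrite synthesis_component scalerK ?of_real_neq0 ?lt0r_neq0 //.
exact: component_preserving_coord Qcp fW.
Qed.

Lemma dual_of_left_inverse V Q L :
  approx_left_inverses eps SV SW W w L ->
  (forall i, V i = L @` (component i @` hsum W)) ->
  {in hsum W, Q =1 Q_of L v} ->
  approx_oblique_cp_dual eps SV SW W w V v Q.
Proof.
move=> [/bounded_operatorP[_ Llin [C LC]] Leps Lim] VE QE.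
have compW i f : hsum W f -> hsum W (component i f) by exact: component_hsum.
have Vsub i : linear_subspace (V i).
  rewrite VE; apply: linear_on_image.
    apply: linear_on_image; first exact: hsum_subspace.
    exact: component_linear_on.
  by move=> a _ _ [f fW <-] [g gW <-]; apply: Llin; exact: compW.
have L0 : L 0 = 0 by exact: linear_on0 (hsum_subspace Wsub) Llin.
have {}QE f : hsum W f -> Q f = Q_of L v f by move=> fW; exact/QE/mem_set.
have QV f : hsum W f -> hsum V (Q f).
  move=> fW i; rewrite QE // ffunE; apply: subspaceZ => //.
  by rewrite VE; exists (component i f) => //; exists f.
have SL f : hsum W f -> synthesis v (Q f) = L f.
  by move=> fW; rewrite QE //; exact: synthesis_Q_of fW.
split; last first.
  (* by [Q_of_component], Q commutes with components *)
  move=> j; apply/seteqP; split=> [_ [_ [f fW <-] <-]|_ [g gV <-]].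
    exists (Q f); first exact: QV.
    by rewrite QE ?QE ?Q_of_component //; exact: compW.
  have := gV j; rewrite VE => -[_ [f fW <-] LfE].
  have vfW := subspaceZ (hsum_subspace Wsub) (of_real k (v j)) fW.
  exists (component j (of_real k (v j) *: f)).
    by exists (of_real k (v j) *: f).
  rewrite QE ?Q_of_component //; last exact: compW.
  apply/ffunP => i; rewrite ffunE [RHS]ffunE; case: eqP => // ->.
  rewrite ffunE componentZ (linear_onZ (hsum_subspace Wsub) Llin);
    last exact: compW.
  by rewrite scalerK ?of_real_neq0 ?lt0r_neq0.
split.
- apply: synthesis_fusion_frame => //; apply/seteqP; split=> [_ [g gV <-]|x].
    apply: synthesis_sub gV; first exact: finite_dim_is_subspace.
    move=> i; rewrite VE -Lim.
    by apply: image_subset; exact: component_image_sub.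
  rewrite -Lim => -[f fW <-]; exists (Q f); [exact: QV | exact: SL].
- apply/bounded_operatorP; split=> // [a f g fW gW|].
    apply/ffunP => i; rewrite ffunE [(_ *: Q f) i]ffunE.
    rewrite !QE //; last exact: (hsum_subspace Wsub).2.
    rewrite !ffunE component_linear Llin; [|exact: compW..].
    by rewrite scalerDr !scalerA mulrC.
  exists (\sum_i (v i)^-1 * C) => f fW f1.
  apply: (le_trans (hsum_norm_le_sum _)); apply: ler_sum => i _.
  have vi0 : 0 <= (v i)^-1 by rewrite invr_ge0 ltW.
  rewrite QE // ffunE -of_realV hnormZ_real // ler_wpM2l //.
  apply: LC; first exact: compW.
  exact: le_trans (hsum_norm_component _ _) f1.
- suff -> : (fun x => synthesis v (Q (analysis W w x)))
      = (fun x => L (analysis W w x)) by [].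
  by apply/funext => x; rewrite SL //; exact: analysis_hsum.
Qed.

End Duals.

Theorem theorem4p3 (R : realType) (k : scalar_kind) (H : hilbertType R k)
    (Hsep : separable H) (SW SV : set H)
    (SWfin : finite_dim_subspace SW) (SVfin : finite_dim_subspace SV)
    (SVW : direct_sum SV (ortho_compl SW))
    (I : finType) (eps : R) (eps_ge0 : 0 <= eps)
    (W : I -> set H) (w : I -> R) (Wframe : fusion_frame SW W w) :
  (forall (V : I -> set H) (v : I -> R) (v_gt0 : forall i, 0 < v i)
          (Q : {ffun I -> H} -> {ffun I -> H}),
     approx_oblique_cp_dual eps SV SW W w V v Q <->
     exists L : {ffun I -> H} -> H,
       [/\ approx_left_inverses eps SV SW W w L,
           L @` hsum W = SV,
           forall i, V i = L @` (component i @` hsum W) &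
           {in hsum W, Q =1 Q_of L v}])
  /\
  (forall L : {ffun I -> H} -> H,
     approx_left_inverses eps SV SW W w L -> L @` hsum W = SV ->
     exists (V : I -> set H) (v : I -> R)
            (Q : {ffun I -> H} -> {ffun I -> H}),
       approx_oblique_cp_dual eps SV SW W w V v Q /\
       {in hsum W, L =1 fun f => synthesis v (Q f)}).
Proof.
have Wsub i := fusion_frame_subspace i Wframe.
split=> [V v v0 Q|L Linv _].
  split=> [dual|[L [Linv _ VE QE]]]; last exact: dual_of_left_inverse QE.
  have [Linv VE QE] := left_inverse_of_dual SVfin Wsub v0 dual.
  by exists (fun f => synthesis v (Q f)); split=> //; case: Linv.
(* any positive weights would do *)
have v0 (i : I) : 0 < (1 : R) by exact: ltr01.
exists (fun i => L @` (component i @` hsum W)), (fun=> 1), (Q_of L (fun=> 1)).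
split=> [|f /set_mem fW].
  exact: (dual_of_left_inverse SVfin Wsub v0 Linv).
have [/bounded_operatorP[_ Llin _] _ _] := Linv.
by rewrite (synthesis_Q_of Wsub Llin v0 fW).
Qed.
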